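(* No tournament on $14$ vertices is intrinsically $5$-linked as a directed graph.
   Context: A tournament on $n$ vertices is a directed graph on $n$ vertices with exactly one directed edge between each pair of distinct vertices (equivalently, the complete graph $K_n$ with a choice of orientation of each edge). Embeddings are embeddings of the graph in $S^3$, in the usual (tame) sense of spatial graph theory. A cycle in a directed graph means a cycle of the underlying undirected graph; it is consistently oriented if its edges all point the same way around the cycle (i.e. it is a directed cycle). A directed graph $G$ is intrinsically $n$-linked as a directed graph (digraph) if every embedding of $G$ in $S^3$ contains $n$ pairwise disjoint, consistently oriented cycles that form a non-split $n$-component link. *)

(* Defs.v *)
From mathcomp Require Import all_boot all_order all_algebra.
From mathcomp Require Import all_classical all_reals all_analysis.

Set Implicit Arguments.
Unset Strict Implicit.
Unset Printing Implicit Defensive.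

Import Order.TTheory GRing.Theory Num.Theory.
Import numFieldNormedType.Exports.

Local Open Scope classical_set_scope.
Local Open Scope ring_scope.

(* A digraph on the finite vertex set T is a relation e : rel T, with e u v
   meaning that there is an edge directed from u to v. *)

Definition tournament (T : finType) (e : rel T) : Prop :=
  irreflexive e /\ forall u v : T, u != v -> e u v (+) e v u.

Definition underlying (T : finType) (e : rel T) : rel T :=
  [rel u v | e u v || e v u].

(* A cycle is given by the sequence of its vertices in cyclic order. *)
Definition graph_cycle (T : finType) (e : rel T) (c : seq T) : Prop :=
  [/\ (2 < size c)%N, uniq c & cycle (underlying e) c].

(* The sequence c may list the vertices along or against the edges. *)
Definition consistently_oriented (T : finType) (e : rel T) (c : seq T) : Prop :=
  cycle e c \/ cycle [rel u v | e v u] c.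

Section Topology.
Variable R : realType.

Definition unit_sphere (d : nat) : set 'rV[R]_d.+1 :=
  [set x | \sum_i x ord0 i ^+ 2 = 1].
Arguments unit_sphere d : clear implicits.

(* All the domains A considered below (spheres and geometric realizations of
   finite graphs) are compact, so that a continuous injection on A is a
   homeomorphism onto its image. *)
Definition embeds (m n : nat) (A : set 'rV[R]_m) (B : set 'rV[R]_n)
    (f : 'rV[R]_m -> 'rV[R]_n) : Prop :=
  [/\ {within A, continuous f}, set_inj A f & f @` A `<=` B].

(* The geodesic simplex of S^3 whose vertices lie on the rays spanned by the
   rows of M: the intersection of S^3 with the cone over these rows. *)
Definition spherical_simplex (k : nat) (M : 'M[R]_(k, 4)) : set 'rV[R]_4 :=
  [set x | unit_sphere 3 x /\
     exists2 a : 'rV[R]_k, (forall i, 0 <= a ord0 i) & x = a *m M].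

Definition polyhedral (X : set 'rV[R]_4) : Prop :=
  exists s : seq {k : nat & 'M[R]_(k, 4)},
    (forall M, M \in s -> row_free (tagged M)) /\
    X = \bigcup_(M in [set` s]) spherical_simplex (tagged M).

Definition tame (X : set 'rV[R]_4) : Prop :=
  exists h : 'rV[R]_4 -> 'rV[R]_4,
    [/\ embeds (unit_sphere 3) (unit_sphere 3) h,
        h @` unit_sphere 3 = unit_sphere 3 &
        polyhedral (h @` X)].

(* A link, given as the union L of its components, is split when some 2-sphere
   in its complement has parts of L on both sides. *)
Definition split_link (L : set 'rV[R]_4) : Prop :=
  exists g : 'rV[R]_3 -> 'rV[R]_4,
    let S := g @` unit_sphere 2 in
    [/\ embeds (unit_sphere 2) (unit_sphere 3) g, tame S, L `&` S = set0 &
        exists x y, [/\ L x, L y &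
          ~ connected_component (unit_sphere 3 `\` S) x y]].

Section Realization.
Variable T : finType.

Definition vertex_point (u : T) : 'rV[R]_#|T| := delta_mx ord0 (enum_rank u).

Definition edge_segment (u v : T) : set 'rV[R]_#|T| :=
  [set x | exists2 t : R, 0 <= t <= 1 &
     x = (1 - t) *: vertex_point u + t *: vertex_point v].

(* Geometric realization of the underlying graph; edge_segment u u is the
   vertex u.  Antiparallel edges would be identified and loops collapsed, so e
   is meant to be an orientation of a simple graph. *)
Definition realization (e : rel T) : set 'rV[R]_#|T| :=
  [set x | exists u v, (u = v \/ e u v) /\ edge_segment u v x].

Definition cycle_realization (c : seq T) : set 'rV[R]_#|T| :=
  \bigcup_(u in [set` c]) edge_segment u (next c u).

Definition spatial_embedding (e : rel T) (f : 'rV[R]_#|T| -> 'rV[R]_4) : Prop :=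
  embeds (realization e) (unit_sphere 3) f /\ tame (f @` realization e).

Definition intrinsically_linked (n : nat) (e : rel T) : Prop :=
  forall f, spatial_embedding e f ->
  exists c : 'I_n -> seq T,
    [/\ forall i, graph_cycle e (c i) /\ consistently_oriented e (c i),
        forall i j x, i != j -> x \in c i -> x \notin c j &
        ~ split_link (\bigcup_i (f @` cycle_realization (c i)))].

End Realization.
End Topology.

Arguments intrinsically_linked R {T} n e.

(* Main.v *)
(* Five disjoint cycles need at least 15 vertices, so it is enough that the
   tournament has a tame embedding at all.  Place the vertices at the points
   (1, t, t^2, t^3) of the moment curve, extend linearly to the realization and
   project radially to S^3.  Any four points of the moment curve are linearly
   independent, so disjoint edges span cones that meet only at 0: this gives
   injectivity, and the image is visibly a union of geodesic arcs. *)
Require Import Defs.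
From mathcomp Require Import all_boot all_order all_algebra.
From mathcomp Require Import all_classical all_reals all_analysis.

Set Implicit Arguments.
Unset Strict Implicit.
Unset Printing Implicit Defensive.

Import Order.TTheory GRing.Theory Num.Theory.
Import numFieldNormedType.Exports.

Local Open Scope classical_set_scope.
Local Open Scope ring_scope.

(** * Linear independence of points of the moment curve *)

Section MomentCurve.
Variables (R : realType) (n : nat).

Definition moment : 'M[R]_(n, 4) := \matrix_(i, j) (i%:R ^+ j).

Lemma sum_mul_moment (x : 'rV[R]_n) : (x *m moment) ord0 ord0 = \sum_i x ord0 i.
Proof. by rewrite mxE; apply: eq_bigr => i _; rewrite mxE expr0 mulr1. Qed.

(** The columns of [moment] are the monomials of degree at most 3 evaluated at the nodes, so a
    linear relation between the rows annihilates every cubic. *)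
Lemma moment_horner (x : 'rV[R]_n) (q : {poly R}) : x *m moment = 0 ->
  (size q <= 4)%N -> \sum_i x ord0 i * q.[i%:R] = 0.
Proof.
move=> x0 q4.
under eq_bigr => i _ do rewrite (horner_coef_wide _ q4) mulr_sumr.
rewrite exchange_big big1 //= => j _.
transitivity (q`_j * (x *m moment) ord0 j); last by rewrite x0 mxE mulr0.
by rewrite mxE mulr_sumr; apply: eq_bigr => i _; rewrite mxE mulrCA.
Qed.

(** The support is bounded by a list that may have repetitions, so that the vertex lists of two
    overlapping simplices can simply be concatenated. *)
Lemma moment_free (s : seq 'I_n) (x : 'rV[R]_n) : (size s <= 4)%N ->
  (forall i, i \notin s -> x ord0 i = 0) -> x *m moment = 0 -> x = 0.
Proof.
move=> s4 xs xm0; apply/rowP => i; rewrite [RHS]mxE.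
have [si|/xs//] := boolP (i \in s).
(* Interpolation: q vanishes at all nodes of s except i. *)
pose r := [seq j <- s | j != i].
pose q : {poly R} := \prod_(j <- r) ('X - (j%:R)%:P).
have q4 : (size q <= 4)%N.
  (* The size of [q] is one more than that of [r], and [r] has lost at least one entry [i] of
     [s]. *)
  rewrite size_prod_XsubC (leq_trans _ s4)// size_filter.
  rewrite -(count_predC (pred1 i)) -[ltnLHS]add0n -addSn leq_add//.
  by rewrite -has_count has_pred1.
have /eqP := moment_horner xm0 q4.
have qE (k : 'I_n) : q.[k%:R] = \prod_(j <- r) (k%:R - j%:R).
  by rewrite horner_prod; apply: eq_bigr => j _; rewrite !hornerE.
(* Only the term of [i] survives, and [q.[i%:R]] is nonzero because distinct naturals stay distinct
   in [R]. *)
rewrite (bigD1 i)//= big1 ?addr0 => [|k ki].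
  rewrite mulf_eq0 => /orP[/eqP //|].
  rewrite qE prodf_seq_eq0 => /hasP[j]; rewrite mem_filter => /andP[ji _] /=.
  by rewrite subr_eq0 eqr_nat eq_sym => /eqP/val_inj ijE; rewrite ijE eqxx in ji.
have [sk|/xs ->] := boolP (k \in s); last by rewrite mul0r.
rewrite qE; suff /eqP -> : \prod_(j <- r) (k%:R - j%:R) == 0 :> R by rewrite mulr0.
by rewrite prodf_seq_eq0; apply/hasP; exists k; rewrite ?mem_filter ?ki//= subrr.
Qed.

End MomentCurve.

(** * Radial projection to the unit sphere *)

Section RadialProjection.
Variable R : realType.

(** The norm that row vectors carry as a normed module is the maximum norm, hence this separate
    Euclidean norm. *)
Definition euclid n (y : 'rV[R]_n) : R := Num.sqrt (\sum_i y ord0 i ^+ 2).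

Definition radial n (y : 'rV[R]_n) : 'rV[R]_n := (euclid y)^-1 *: y.

Lemma euclid_ge0 n (y : 'rV[R]_n) : 0 <= euclid y.
Proof. exact: sqrtr_ge0. Qed.

Lemma sqr_euclid n (y : 'rV[R]_n) : euclid y ^+ 2 = \sum_i y ord0 i ^+ 2.
Proof. by rewrite sqr_sqrtr// sumr_ge0// => i _; rewrite sqr_ge0. Qed.

Lemma euclid_gt0 n (y : 'rV[R]_n) : y != 0 -> 0 < euclid y.
Proof.
move=> y0; rewrite lt_def euclid_ge0 andbT -sqrf_eq0 sqr_euclid.
apply: contra_neq y0 => /eqP; rewrite psumr_eq0 => [/allP h|i _]; last exact: sqr_ge0.
by apply/rowP => i; rewrite mxE; apply/eqP; rewrite -sqrf_eq0; exact: h (mem_index_enum _).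
Qed.

Lemma radial_sphere d (y : 'rV[R]_d.+1) : y != 0 -> @unit_sphere R d (radial y).
Proof.
move=> /euclid_gt0 y0; rewrite /unit_sphere/=.
under eq_bigr => i _ do rewrite mxE exprMn.
by rewrite -mulr_sumr -sqr_euclid -exprMn mulVf ?expr1n// gt_eqF.
Qed.

Lemma radial_id d (y : 'rV[R]_d.+1) : @unit_sphere R d y -> radial y = y.
Proof. by rewrite /radial /euclid => ->; rewrite sqrtr1 invr1 scale1r. Qed.

Lemma radialZ n (c : R) (y : 'rV[R]_n) : 0 < c -> radial (c *: y) = radial y.
Proof.
move=> c0; rewrite /radial.
have -> : euclid (c *: y) = c * euclid y.
  apply: (pexpIrn (n := 2)) => //; rewrite ?nnegrE ?euclid_ge0 ?mulr_ge0 ?euclid_ge0 ?ltW//.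
  rewrite exprMn !sqr_euclid mulr_sumr.
  by apply: eq_bigr => i _; rewrite mxE exprMn.
by rewrite scalerA invfM mulrAC mulVf ?mul1r// gt_eqF.
Qed.

Lemma continuous_sum (X : topologicalType) (V : normedModType R) (I : Type)
    (r : seq I) (F : I -> X -> V) :
  (forall i, continuous (F i)) -> continuous (fun x => \sum_(i <- r) F i x).
Proof. by move=> F_cont; apply: continuous_big => //; exact: add_continuous. Qed.

Lemma continuous_euclid n : continuous (@euclid n).
Proof.
move=> y; apply: (@continuous_comp _ _ _ (fun z : 'rV[R]_n => \sum_i z ord0 i ^+ 2)
  (@Num.sqrt R)); last exact: sqrt_continuous.
apply: (@continuous_sum _ R^o) => i z.
apply: (@continuous_comp _ _ _ (fun z : 'rV[R]_n => z ord0 i) (fun t : R => t ^+ 2)).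
  exact: coord_continuous.
exact: exprn_continuous.
Qed.

Lemma continuous_radial n (y : 'rV[R]_n) : y != 0 -> {for y, continuous (@radial n)}.
Proof.
move=> /euclid_gt0 y0; apply: (@cvgZ _ _ _ (nbhs y)); last exact: cvg_id.
apply: (@continuous_comp _ _ _ (@euclid n) (@GRing.inv R)).
  exact: continuous_euclid.
by apply: inv_continuous; rewrite gt_eqF.
Qed.

Lemma continuous_mulmxr m n (P : 'M[R]_(m, n)) :
  continuous (fun x : 'rV[R]_m => x *m P).
Proof.
under eq_fun do rewrite mulmx_sum_row.
apply: continuous_sum => i x.
apply: (@cvgZr_tmp _ _ _ (nbhs x)); exact: coord_continuous.
Qed.

End RadialProjection.

(** * Simplices spanned by points of the moment curve *)

Section MomentSimplices.
Variables (R : realType) (n : nat).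
Let M := moment R n.

(** A face of the standard simplex. Only the set of entries of [l] matters, so [[:: i; i]] gives a
    single vertex. *)
Definition std_simplex (l : seq 'I_n) : set 'rV[R]_n :=
  [set x | [/\ forall i, 0 <= x ord0 i, forall i, i \notin l -> x ord0 i = 0 &
    \sum_i x ord0 i = 1]].

Definition moment_map (x : 'rV[R]_n) : 'rV[R]_4 := radial (x *m M).

(** The first column of [M] is constantly 1, so the first coordinate of [x *m M] is the coordinate
    sum of [x]. *)
Lemma std_simplex_neq0 l x : std_simplex l x -> x *m M != 0.
Proof.
move=> [_ _ x1]; apply/eqP => /rowP/(_ ord0).
by rewrite sum_mul_moment x1 mxE => /eqP; rewrite oner_eq0.
Qed.

Lemma moment_map_sphere l x : std_simplex l x -> @unit_sphere R 3 (moment_map x).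
Proof. by move=> /std_simplex_neq0; exact: radial_sphere. Qed.

Lemma continuous_moment_map l x : std_simplex l x -> {for x, continuous moment_map}.
Proof.
move=> /std_simplex_neq0 x0.
apply: (@continuous_comp _ _ _ (fun z : 'rV[R]_n => z *m M) (@radial R 4) x).
  exact: continuous_mulmxr.
exact: continuous_radial.
Qed.

(** Equal projections give [x *m M = c *: (y *m M)], with [c] the ratio of the norms. Then
    [x - c *: y] is a relation on at most four points, hence zero, and comparing coordinate sums
    gives [c = 1]. Simplices sharing vertices are covered too. *)
Lemma moment_map_inj l1 l2 x y : (size l1 + size l2 <= 4)%N ->
  std_simplex l1 x -> std_simplex l2 y -> moment_map x = moment_map y -> x = y.
Proof.
move=> l4 xl yl.
have /euclid_gt0 x0 := std_simplex_neq0 xl; have /euclid_gt0 y0 := std_simplex_neq0 yl.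
move: xl yl => [_ xl x1] [_ yl y1].
rewrite /moment_map /radial => /(congr1 (fun z => euclid (x *m M) *: z)).
rewrite !scalerA mulfV ?gt_eqF// scale1r; set c := _ / _ => xyM.
have xcy : x - c *: y = 0.
  apply: (@moment_free R n (l1 ++ l2)) => [|i|]; first by rewrite size_cat.
    by rewrite mem_cat negb_or !mxE => /andP[/xl -> /yl ->]; rewrite mulr0 subrr.
  by rewrite mulmxBl -scalemxAl xyM subrr.
move/eqP: xcy; rewrite subr_eq0 => /eqP xcy.
have := x1; rewrite xcy; under eq_bigr => i _ do rewrite mxE.
by rewrite -mulr_sumr y1 mulr1 => ->; rewrite scale1r.
Qed.

Section InjectiveRows.
Variables (k : nat) (f : 'I_k -> 'I_n).
Hypothesis f_inj : injective f.

(** Padding by zeros: entry [i] moves to position [f i]. This translates coefficients on the chosen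
    rows into points supported on [codom f]. *)
Let extend (a : 'rV[R]_k) : 'rV[R]_n := a *m rowsub f 1%:M.

Let extend_f a i : extend a ord0 (f i) = a ord0 i.
Proof.
rewrite mxE (bigD1 i)//= big1 ?addr0 => [|j ji]; rewrite !mxE ?eqxx ?mulr1//.
by rewrite (inj_eq f_inj) (negbTE ji) mulr0.
Qed.

Let extend_out a i : i \notin codom f -> extend a ord0 i = 0.
Proof.
move=> fi; rewrite mxE big1// => j _; rewrite !mxE; case: eqP => [ji|]; rewrite ?mulr0//.
by rewrite -ji codom_f in fi.
Qed.

Let extendM a : extend a *m M = a *m rowsub f M.
Proof. by rewrite -mulmxA mul_rowsub_mx mul1mx. Qed.

Let sum_extend a : \sum_i extend a ord0 i = \sum_i a ord0 i.
Proof.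
under eq_bigr => i _ do rewrite mxE.
rewrite exchange_big; apply: eq_bigr => i _ /=.
rewrite -mulr_sumr (bigD1 (f i))//= big1 ?addr0 => [|j ji]; rewrite !mxE ?eqxx ?mulr1//.
by rewrite eq_sym (negbTE ji).
Qed.

(** A row of the left kernel, padded by zeros, is a relation on at most four points of the curve. *)
Lemma row_free_moment : (k <= 4)%N -> row_free (rowsub f M).
Proof.
move=> k4; rewrite -kermx_eq0; apply/eqP/row_matrixP => i; rewrite row0.
set a := row i _.
have /(moment_free _ (@extend_out a)) : extend a *m M = 0.
  by rewrite extendM; apply/sub_kermxP; exact: row_sub.
rewrite size_codom card_ord => /(_ k4) a0.
by apply/rowP => j; rewrite -extend_f a0 !mxE.
Qed.

(** Each ray of the cone meets both the sphere and the slice of coordinate sum 1; rescaling along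
    rays passes from one to the other. *)
Lemma spherical_simplex_moment :
  spherical_simplex (rowsub f M) = moment_map @` std_simplex (codom f).
Proof.
apply/seteqP; split => [y [y1 [a a0 yE]]|_ [x xf <-]].
  (* If the nonnegative coefficients summed to 0, they would all vanish and the origin would lie on
     the sphere. *)
  have s0 : 0 < \sum_i a ord0 i.
    rewrite lt_def sumr_ge0 ?andbT => [|i _]; last exact: a0.
    rewrite psumr_eq0 => [|i _]; last exact: a0.
    apply/negP => /allP /= z; suff a00 : a = 0.
      move: y1; rewrite yE a00 mul0mx /unit_sphere/= big1 => [/eqP|i _].
        by rewrite eq_sym oner_eq0.
      by rewrite mxE expr0n.
    by apply/rowP => i; rewrite mxE; apply/eqP; exact: z (mem_index_enum _).
  set s := \sum_i _ in s0; exists (s^-1 *: extend a).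
    split => [i|i fi|].
    - rewrite mxE mulr_ge0 ?invr_ge0 ?(ltW s0)//.
      have [/codomP[j ->]|fi] := boolP (i \in codom f); first by rewrite extend_f.
      by rewrite extend_out.
    - by rewrite mxE extend_out ?mulr0.
    - under eq_bigr => i _ do rewrite mxE.
      by rewrite -mulr_sumr sum_extend mulVf ?gt_eqF.
  by rewrite /moment_map -scalemxAl extendM -yE radialZ ?invr_gt0 // radial_id.
split; first exact: moment_map_sphere xf.
have x0 := std_simplex_neq0 xf; case: xf => [x_ge0 xf x1].
pose a := \row_i x ord0 (f i).
have -> : x = extend a.
  apply/rowP => i; have [/codomP[j ->]|fi] := boolP (i \in codom f).
    by rewrite extend_f mxE.
  by rewrite xf// extend_out.
exists ((euclid (extend a *m M))^-1 *: a).
  by move=> i; rewrite !mxE mulr_ge0 ?invr_ge0 ?euclid_ge0.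
by rewrite -scalemxAl -extendM.
Qed.

End InjectiveRows.

(** The injective choice of rows is [tnth] of the list itself: [uniq l] makes it injective, and its
    codomain is [l]. *)
Lemma polyhedral_moment (ls : seq (seq 'I_n)) :
  (forall l, l \in ls -> uniq l /\ (size l <= 4)%N) ->
  polyhedral (moment_map @` \bigcup_(l in [set` ls]) std_simplex l).
Proof.
move=> lsP; pose N (l : seq 'I_n) : {k : nat & 'M[R]_(k, 4)} :=
  Tagged (fun k => 'M[R]_(k, 4)) (rowsub (tnth (in_tuple l)) M).
exists [seq N l | l <- ls]; split.
  move=> _ /mapP[l /lsP[lu l4] ->]; apply: row_free_moment => //.
  exact/tuple_uniqP.
rewrite image_bigcup; apply/seteqP; split => [y [l /= lls ly]|y [_ /mapP[l lls ->]]].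
- exists (N l); first by rewrite /= map_f.
  rewrite /= spherical_simplex_moment; last by apply/tuple_uniqP; case: (lsP _ lls).
  by rewrite codomE map_tnth_enum.
- rewrite /= spherical_simplex_moment => [|]; last by apply/tuple_uniqP; case: (lsP _ lls).
  by rewrite codomE map_tnth_enum => ly; exists l.
Qed.

End MomentSimplices.

(** * The tame embedding of the realization *)

Section Embedding.
Variables (R : realType) (T : finType).

Lemma edge_segment_std_simplex (u v : T) :
  @edge_segment R T u v = @std_simplex R _ [:: enum_rank u; enum_rank v].
Proof.
have vE (w : T) i : @vertex_point R T w ord0 i = (i == enum_rank w)%:R.
  by rewrite mxE eqxx.
have vS (w : T) : \sum_i (@vertex_point R T w) ord0 i = 1.
  rewrite (bigD1 (enum_rank w))//= big1 ?addr0 => [|j ji]; rewrite vE ?eqxx//.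
  by rewrite (negbTE ji).
apply/seteqP; split => [x [t /andP[t0 t1] ->]|x [x0 xuv x1]].
  split => [i|i|].
  - by rewrite !mxE addr_ge0// mulr_ge0 ?ler0n// subr_ge0.
  - rewrite !inE negb_or => /andP[iu iv].
    by rewrite !mxE (negbTE iu) (negbTE iv) !andbF !mulr0 addr0.
  - under eq_bigr => i _ do rewrite [_ ord0 i]mxE [in X in X + _]mxE [in X in _ + X]mxE.
    by rewrite big_split/= -!mulr_sumr !vS !mulr1 subrK.
(* For [u = v] the two coordinates coincide, and the segment is one point. *)
have [uv|uv] := eqVneq u v.
  subst v; exists 0; first by rewrite lexx ler01.
  rewrite subr0 scale1r scale0r addr0; apply/rowP => i; rewrite vE.
  have [->|iu] := eqVneq i (enum_rank u); last by rewrite xuv// !inE (negbTE iu).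
  move: x1; rewrite (bigD1 (enum_rank u))//= big1 ?addr0// => j ju.
  by rewrite xuv// !inE (negbTE ju).
have uv' : enum_rank v != enum_rank u by rewrite (inj_eq enum_rank_inj) eq_sym.
have {}x1 : x ord0 (enum_rank u) + x ord0 (enum_rank v) = 1.
  rewrite -[RHS]x1 (bigD1 (enum_rank u))//= (bigD1 (enum_rank v))//=.
  by rewrite big1 ?addr0// => j /andP[ju jv]; rewrite xuv// !inE negb_or ju.
(* The parameter is the barycentric coordinate at [v]. *)
exists (x ord0 (enum_rank v)).
  by rewrite x0 -x1 lerDr x0.
rewrite -[in 1 - _]x1 addrK; apply/rowP => i; rewrite !mxE eqxx/=.
have [->|iu] := eqVneq i (enum_rank u).
  by rewrite eq_sym (negbTE uv') mulr1 mulr0 addr0.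
have [->|iv] := eqVneq i (enum_rank v); first by rewrite mulr0 mulr1 add0r.
by rewrite !mulr0 addr0 xuv// !inE negb_or iu.
Qed.

Lemma exists_spatial_embedding (e : rel T) : irreflexive e ->
  exists f, @spatial_embedding R T e f.
Proof.
move=> e_irr; exists (@moment_map R #|T|).
(* Vertices get one-entry lists here, since [polyhedral_moment] requires lists without repetition;
   for edges this follows from irreflexivity. *)
pose ls := [seq [:: enum_rank u] | u <- enum T] ++
  [seq [:: enum_rank uv.1; enum_rank uv.2]
     | uv <- enum [pred uv : T * T | e uv.1 uv.2]].
(* For injectivity every point is put on a list of two entries, possibly equal, so that two such
   lists have four entries in all. *)
have segE x : @realization R T e x ->
    exists u v, @std_simplex R _ [:: enum_rank u; enum_rank v] x.
  by move=> [u [v [_ x_uv]]]; exists u, v; rewrite -edge_segment_std_simplex.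
have realE : @realization R T e = \bigcup_(l in [set` ls]) @std_simplex R _ l.
  apply/seteqP; split => [x [u [v [uv]]]|x [l /=]].
    rewrite edge_segment_std_simplex => x_uv.
    case: uv => [uv|uv].
      exists [:: enum_rank u]; first by rewrite /= mem_cat map_f ?mem_enum.
      by case: x_uv => x0 xuv x1; split => // i iu; apply: xuv; rewrite -uv !inE orbb -mem_seq1.
    exists [:: enum_rank u; enum_rank v] => //=.
    by rewrite mem_cat orbC (map_f _ (x := (u, v)))// mem_enum.
  rewrite mem_cat => /orP[/mapP[u _ ->]|/mapP[[u v]]].
    move=> [x0 xu x1]; exists u, u; split; first by left.
    rewrite edge_segment_std_simplex; split => // i iu; apply: xu.
    by apply: contra iu; rewrite !inE => ->.
  rewrite mem_enum => uv -> x_uv; exists u, v; split; first by right.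
  by rewrite edge_segment_std_simplex.
split; first split.
- apply: continuous_in_subspaceT => x; rewrite inE => /segE[u [v x_uv]].
  exact: continuous_moment_map x_uv.
- move=> x y; rewrite !inE => /segE[u [v x_uv]] /segE[w [z y_wz]].
  exact: (moment_map_inj _ x_uv y_wz).
- by move=> _ [x /segE[u [v x_uv]] <-]; exact: moment_map_sphere x_uv.
(* The image is already polyhedral, so the identity witnesses tameness. *)
exists id; split; rewrite ?image_id//.
  split; [|by move=> ? ?|by rewrite image_id].
  by apply: continuous_subspaceT => x; exact: cvg_id.
rewrite realE; apply: polyhedral_moment => l.
rewrite mem_cat => /orP[/mapP[u _ ->]//|/mapP[[u v]]].
rewrite mem_enum => uv -> /=; split => //; rewrite andbT inE (inj_eq enum_rank_inj).
by apply: contraTneq uv => ->; rewrite inE/= e_irr.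
Qed.

End Embedding.

(** * Counting the vertices of disjoint cycles *)

Lemma disjoint_cycles_card (T : finType) (e : rel T) k (c : 'I_k -> seq T) :
  (forall i, graph_cycle e (c i)) ->
  (forall i j x, i != j -> x \in c i -> x \notin c j) -> (k * 3 <= #|T|)%N.
Proof.
move=> cC c_disj.
rewrite -{1}[k]card_ord -sum_nat_const -sum1_card.
(* Double counting of the pairs [(i, x)] with [x \in c i]: each cycle contributes at least three,
   each vertex at most one. *)
apply: (@leq_trans (\sum_(i < k) \sum_x (x \in c i))%N).
  apply: leq_sum => i _; have [c3 /card_uniqP cu _] := cC i.
  by rewrite -big_mkcond sum1_card cu.
rewrite exchange_big; apply: leq_sum => x _ /=.
have [i xi|xc] := pickP (fun i => x \in c i); last by rewrite big1// => i _; rewrite xc.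
rewrite (bigD1 i)//= xi big1// => j ji; rewrite eq_sym in ji.
by rewrite (negbTE (c_disj _ _ _ ji xi)).
Qed.

Theorem proposition6p1 (R : realType) (T : finType) (e : rel T) :
  #|T| = 14%N -> tournament e -> ~ intrinsically_linked R 5 e.
Proof.
move=> T14 [e_irr _] e_linked.
have [f /e_linked[c [cC c_disj _]]] := exists_spatial_embedding R e_irr.
(* The count would give [5 * 3 <= 14], false by computation. *)
by have := disjoint_cycles_card (fun i => (cC i).1) c_disj; rewrite T14.
Qed.
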